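(* Let $r\ge 4$ be a fixed integer. The number of pairwise non-congruent triangles associated with $D(4)$-triples and having shortest side $r$ equals the number of positive divisors $a$ of $r^2-4$ satisfying $$\frac{\sqrt{5r^2-16}-r}{2}<a<\sqrt{r^2-4}.$$
   Context: A $D(4)$-triple is a set of three distinct positive integers such that the product of any two distinct elements, increased by $4$, is a perfect square. For a $D(4)$-triple $\{a,b,c\}$ with $a<b<c$, put $r=\sqrt{ab+4}$, $s=\sqrt{ac+4}$, $t=\sqrt{bc+4}$; these are positive integers with $r<s<t$. If $r+s>t$, the (non-degenerate) triangle with side lengths $r,s,t$ is called the triangle associated with the $D(4)$-triple $\{a,b,c\}$; if $r+s\le t$, no triangle is associated with $\{a,b,c\}$. *)

(* Defs.v *)
From mathcomp Require Import all_boot all_order all_algebra.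
From mathcomp Require Import boolp classical_sets functions cardinality reals.

Set Implicit Arguments.
Unset Strict Implicit.
Unset Printing Implicit Defensive.

Import Order.TTheory GRing.Theory Num.Theory.

Definition D4_triple (a b c : nat) : Prop :=
  [/\ [&& (0 < a)%N, (0 < b)%N & (0 < c)%N], uniq [:: a; b; c],
      exists x : nat, (a * b + 4 = x ^ 2)%N,
      exists x : nat, (a * c + 4 = x ^ 2)%N
    & exists x : nat, (b * c + 4 = x ^ 2)%N].

Local Open Scope ring_scope.

(* The product type also carries a max-norm in MathComp-Analysis; the distance
   used here is the Euclidean one, [dist] below. *)
Definition plane (R : realType) := (R * R)%type.

Definition dist (R : realType) (P Q : plane R) : R :=
  Num.sqrt ((P.1 - Q.1) ^+ 2 + (P.2 - Q.2) ^+ 2).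

Record triangle (R : realType) := Triangle {
  vA : plane R;
  vB : plane R;
  vC : plane R;
  not_collinear :
    (vB.1 - vA.1) * (vC.2 - vA.2) - (vB.2 - vA.2) * (vC.1 - vA.1) != 0
}.

Definition vertices (R : realType) (T : triangle R) : seq (R * R) :=
  [:: vA T; vB T; vC T].

Definition sides (R : realType) (T : triangle R) : seq R :=
  [:: dist (vA T) (vB T); dist (vB T) (vC T); dist (vC T) (vA T)].

(* A distance-preserving self-map of the plane is automatically bijective. *)
Definition plane_isometry (R : realType) (f : plane R -> plane R) : Prop :=
  forall P Q, dist (f P) (f Q) = dist P Q.

(* Reflections are allowed, and the vertices may be matched in any order. *)
Definition congruent (R : realType) (T1 T2 : triangle R) : Prop :=
  exists2 f : plane R -> plane R,
    plane_isometry f & perm_eq (map f (vertices T1)) (vertices T2).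

Definition associated (R : realType) (a b c : nat) (T : triangle R) : Prop :=
  let r : R := Num.sqrt (a * b + 4)%N%:R in
  let s : R := Num.sqrt (a * c + 4)%N%:R in
  let t : R := Num.sqrt (b * c + 4)%N%:R in
  t < r + s /\ perm_eq (sides T) [:: r; s; t].

Definition D4_triangle (R : realType) (T : triangle R) : Prop :=
  exists a b c : nat,
    [/\ D4_triple a b c, (a < b < c)%N & associated a b c T].

Definition shortest_side (R : realType) (T : triangle R) (l : R) : Prop :=
  l \in sides T /\ {in sides T, forall x, l <= x}.

Definition congruence_class (R : realType) (T : triangle R) : set (triangle R) :=
  [set T' | congruent T T']%classic.

Definition D4_congruence_classes (R : realType) (r : nat) :
    set (set (triangle R)) :=
  [set congruence_class T | T in
     [set T : triangle R | D4_triangle T /\ shortest_side T r%:R]]%classic.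

Arguments D4_congruence_classes R r : clear implicits.

(* [divisors] lists the positive divisors without repetition. *)
Definition divisors_in_range (R : realType) (r : nat) : seq nat :=
  [seq a <- divisors (r ^ 2 - 4) |
     (Num.sqrt (5 * (r%:R : R) ^+ 2 - 16) - r%:R) / 2 < a%:R
       < Num.sqrt ((r%:R : R) ^+ 2 - 4)].

(* Main.v *)
Require Import Defs.
From mathcomp Require Import all_boot all_order all_algebra.
From mathcomp Require Import boolp classical_sets functions cardinality reals.
From mathcomp Require Import zify ring lra.

(* Let c be the largest element of a D(4)-triple {a, b, c} and put
   d = a + b + c + (abc - rst) / 2.  Then ad + 4, bd + 4 and cd + 4 are squares,
   which forces d >= 0, and
   d (a + b + c + (abc + rst) / 2) = (c - a - b)^2 - 4 r^2,
   so that c >= a + b + 2r, with equality iff d = 0.  If d > 0, write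
   x^2 = ad + 4, y^2 = bd + 4; then 2 (t - s) = (b - r) x + (r - a) y, and the
   gap inequality applied to {a, b, d} or {a, d, b} gives t - s >= r.  Hence a
   triangle can only come from c = a + b + 2r; its sides are r, a + r, b + r,
   and the triangle inequality is b < a + r, where ab = r^2 - 4.  By the
   side-side-side criterion the congruence class is determined by a. *)

Set Implicit Arguments.
Unset Strict Implicit.
Unset Printing Implicit Defensive.

Import Order.TTheory GRing.Theory Num.Theory.

Local Open Scope ring_scope.

(** * Arithmetic of D(4)-pairs and the gap inequality *)

Lemma sqr_add4_neq (n m : int) : 0 < n -> n * n + 4 <> m * m.
Proof.
move=> n0 E.
wlog m0 : m E / 0 <= m.
  move=> W; case: (lerP 0 m) => [/W|m0]; first exact.
  by apply: (W (- m)); lia.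
have nm : n < m by nia.
have [Em|mn] : m = n + 1 \/ n + 2 <= m by lia.
  by rewrite Em in E; lia.
nia.
Qed.

Lemma even_subr_of_sqr (m n k : int) :
  m * m - n * n = 2 * k -> exists j, m - n = 2 * j.
Proof.
move=> E.
have [j [Ej|Ej]] : exists j, m - n = 2 * j \/ m - n = 2 * j + 1.
  by exists ((m - n) %/ 2)%Z; lia.
  by exists j.
have : m = n + 2 * j + 1 by lia.
by move=> Em; rewrite Em in E; lia.
Qed.

(** The cases [w = p + 1] and [w = p + 2] give the two outcomes, and a larger [w] needs [q > 8].
    With [q = c], each [c <= 8] leaves at most one [p], so no D(4)-triple has its largest element at
    most 8. *)
Lemma small_D4_pair (p q w : int) :
  0 < p < q -> q <= 8 -> 0 <= w -> p * q + 4 = w * w ->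
  q = p + 4 \/ p = 3 /\ q = 4.
Proof.
move=> pq q8 w0 E.
have [Ew|[Ew|Ew]] : w = p + 1 \/ w = p + 2 \/ p + 3 <= w by nia.
- have : p * (p + 2 - q) = 3 by rewrite Ew in E; lia.
  by have [?|[?|?]] : p + 2 - q <= 0 \/ p + 2 - q = 1 \/ p + 2 - q >= 2; nia.
- left; suff : p * (q - (p + 4)) = 0 by nia.
  by rewrite Ew in E; lia.
- nia.
Qed.

(** [a] and [b] are left unordered because the bound is applied both to [{a, b, d}] and to
    [{a, d, b}], where the order of [a] and [d] is unknown. *)
Lemma D4_gap (a b c r s t : int) :
  0 < a < c -> 0 < b < c -> a <> b -> 0 <= r -> 0 <= s -> 0 <= t ->
  a * b + 4 = r * r -> a * c + 4 = s * s -> b * c + 4 = t * t ->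
  a + b + 2 * r <= c.
Proof.
move=> ac bc ab r0 s0 t0 Er Es Et.
(* [e] is the integer [2 d]; the identity [Ee] reads [4 (c d + 4) = (s t - c r)^2], so [e < 0] would
   force [c <= 8]. *)
set e := 2 * (a + b + c) + a * b * c - r * s * t.
have e0 : 0 <= e.
  case: (lerP 0 e) => // eneg.
  have Ee : 2 * (c * e) + 16 = (s * t - c * r) ^+ 2.
    transitivity ((s * s) * (t * t) + c * c * (r * r) - 2 * c * r * s * t);
      last by ring.
    by rewrite -Er -Es -Et /e; ring.
  have c8 : c <= 8.
    have : 0 <= 2 * (c * e) + 16 by rewrite Ee sqr_ge0.
    nia.
  have := small_D4_pair ac c8 s0 Es; have := small_D4_pair bc c8 t0 Et; lia.
have : 0 <= e * (2 * (a + b + c) + a * b * c + r * s * t).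
  by rewrite mulr_ge0 // !addr_ge0 ?mulr_ge0 //; lia.
have -> : e * (2 * (a + b + c) + a * b * c + r * s * t) =
    4 * ((c - a - b) ^+ 2 - 4 * r ^+ 2).
  transitivity ((2 * (a + b + c) + a * b * c) ^+ 2
                - (r * r) * (s * s) * (t * t)); first by rewrite /e; ring.
  by rewrite expr2 -Er -Es -Et [r ^+ 2]expr2 -Er; ring.
(* Excludes the other branch [c <= a + b - 2 r], which would put [c] below [a] or [b]. *)
have rab : a < r \/ b < r by nia.
nia.
Qed.

Lemma ler_of_mulrr (m n : int) : 0 <= n -> m * m <= n * n -> m <= n.
Proof. nia. Qed.

Lemma ltr_of_mulrr (m n : int) : 0 <= n -> m * m < n * n -> m < n.
Proof. nia. Qed.

(** * Descent to a fourth element, and the effect of the triangle inequality *)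

Lemma D4_descent (a b c r s t : int) :
  0 < a < b -> b < c -> 0 <= r -> 0 <= s -> 0 <= t ->
  a * b + 4 = r * r -> a * c + 4 = s * s -> b * c + 4 = t * t ->
  c <> a + b + 2 * r ->
  exists d x y : int,
    [/\ 0 < d, 0 <= x, 0 <= y, a * d + 4 = x * x & b * d + 4 = y * y] /\
    [/\ 2 * s = a * y + r * x & 2 * t = b * x + r * y].
Proof.
move=> ab bc r0 s0 t0 Er Es Et creg.
(* Each explicit argument of [even_subr_of_sqr] is half the difference of the two squares, expanded
   by [Er], [Es], [Et]. *)
have [x Ex] : exists x, r * s - a * t = 2 * x.
  apply: (@even_subr_of_sqr _ _ (2 * a * (b + c - a) + 8)).
  transitivity ((r * r) * (s * s) - a * a * (t * t)); first by ring.
  by rewrite -Er -Es -Et; ring.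
have [y Ey] : exists y, r * t - b * s = 2 * y.
  apply: (@even_subr_of_sqr _ _ (2 * b * (a + c - b) + 8)).
  transitivity ((r * r) * (t * t) - b * b * (s * s)); first by ring.
  by rewrite -Er -Es -Et; ring.
have [d' Ed'] : exists d, a * b * c - r * s * t = 2 * d.
  apply: (@even_subr_of_sqr _ _
    (- (2 * (a * b * c * (a + b + c)) + 8 * (a * b + b * c + a * c) + 32))).
  transitivity ((a * b * c) ^+ 2 - (r * r) * (s * s) * (t * t)); first by ring.
  by rewrite -Er -Es -Et; ring.
have [d Ed] : exists d, d = a + b + c + d' by eexists.
have E2d : 2 * d = 2 * (a + b + c) + a * b * c - r * s * t by lia.
have adx : a * d + 4 = x * x.
  suff : 4 * (a * d + 4) = (2 * x) * (2 * x) by lia.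
  rewrite -Ex.
  transitivity ((r * r) * (s * s) + a * a * (t * t) - 2 * a * (r * s * t));
    last by ring.
  have -> : r * s * t = 2 * (a + b + c) + a * b * c - 2 * d by lia.
  by rewrite -Er -Es -Et; ring.
have bdy : b * d + 4 = y * y.
  suff : 4 * (b * d + 4) = (2 * y) * (2 * y) by lia.
  rewrite -Ey.
  transitivity ((r * r) * (t * t) + b * b * (s * s) - 2 * b * (r * s * t));
    last by ring.
  have -> : r * s * t = 2 * (a + b + c) + a * b * c - 2 * d by lia.
  by rewrite -Er -Es -Et; ring.
(* The linear map from [(s, t)] to [(2 x, 2 y)] has determinant [r^2 - a b = 4]; this and [txy]
   invert it. *)
have sxy : 2 * s = a * y + r * x.
  suff : 4 * s = a * (2 * y) + r * (2 * x) by lia.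
  rewrite -Ex -Ey; transitivity (s * (r * r - a * b)); last by ring.
  by rewrite -Er; ring.
have txy : 2 * t = b * x + r * y.
  suff : 4 * t = b * (2 * x) + r * (2 * y) by lia.
  rewrite -Ex -Ey; transitivity (t * (r * r - a * b)); last by ring.
  by rewrite -Er; ring.
have gap : a + b + 2 * r <= c.
  by apply: (@D4_gap a b c r s t) => //; lia.
exists d, x, y; split; split => //.
- have : 0 < 2 * d * (2 * (a + b + c) + a * b * c + r * s * t).
    have -> : 2 * d * (2 * (a + b + c) + a * b * c + r * s * t) =
        4 * ((c - a - b) ^+ 2 - 4 * r ^+ 2).
      rewrite E2d; transitivity ((2 * (a + b + c) + a * b * c) ^+ 2
                - (r * r) * (s * s) * (t * t)); first by ring.
      by rewrite -Er -Es -Et [r ^+ 2]expr2 -Er; ring.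
    have : (2 * r) ^+ 2 < (c - a - b) ^+ 2 by rewrite ltr_pXn2r ?nnegrE; lia.
    lia.
  have : 0 <= r * s * t by rewrite !mulr_ge0.
  have : 0 <= a * b * c by rewrite !mulr_ge0; lia.
  by move=> ? ?; rewrite pmulr_lgt0; lia.
- suff : a * t <= r * s by lia.
  apply: ler_of_mulrr; first by rewrite mulr_ge0.
  have : 0 <= a * (b + c - a) by rewrite mulr_ge0; lia.
  by rewrite (mulrACA r) (mulrACA a) -Er -Es -Et; lia.
- suff : b * s <= r * t by lia.
  apply: ler_of_mulrr; first by rewrite mulr_ge0.
  have : 0 <= b * (a + c - b) by rewrite mulr_ge0; lia.
  by rewrite (mulrACA r) (mulrACA b) -Er -Es -Et; lia.
Qed.

Lemma D4_triangle_regular (a b c r s t : int) :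
  0 < a < b -> b < c -> 0 <= r -> 0 <= s -> 0 <= t ->
  a * b + 4 = r * r -> a * c + 4 = s * s -> b * c + 4 = t * t ->
  t < r + s -> c = a + b + 2 * r.
Proof.
move=> ab bc r0 s0 t0 Er Es Et tri.
have [//|/eqP creg] := eqVneq c (a + b + 2 * r).
have [d [x [y [[d0 x0 y0 adx bdy] [sxy txy]]]]] :=
  D4_descent ab bc r0 s0 t0 Er Es Et creg.
suff : 2 * r <= (b - r) * x + (r - a) * y by nia.
(* [d = a] would make [a^2 + 4] a square, and likewise for [b]; [D4_gap] asks for distinct
   elements. *)
have da : d <> a by move=> Eda; apply: (@sqr_add4_neq a x); rewrite -?Eda; lia.
have db : d <> b by move=> Edb; apply: (@sqr_add4_neq b y); rewrite -?Edb; lia.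
have ra : a < r.
  have : a * a < a * b by rewrite ltr_pM2l; lia.
  by move=> ?; apply: ltr_of_mulrr => //; lia.
have [bd|bd] : b < d \/ d < b by lia.
  have gap : a + b + 2 * r <= d.
    by apply: (@D4_gap a b d r x y) => //; lia.
  have rb : r <= b by nia.
  have xar : a + r <= x.
    apply: ler_of_mulrr; first by lia.
    rewrite -adx.
    have : a * (a + b + 2 * r) <= a * d by rewrite ler_pM2l; lia.
    lia.
  have ybr : b + r <= y.
    apply: ler_of_mulrr; first by lia.
    rewrite -bdy.
    have : b * (a + b + 2 * r) <= b * d by rewrite ler_pM2l; lia.
    lia.
  (* The two lower bounds add up to [2 r (b - a)], which is at least [2 r]. *)
  have H1 : (b - r) * (a + r) <= (b - r) * x by rewrite ler_wpM2l; lia.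
  have H2 : (r - a) * (b + r) <= (r - a) * y by rewrite ler_wpM2l; lia.
  apply: le_trans (lerD H1 H2).
  have : 0 <= r * (b - a - 1) by rewrite mulr_ge0; lia.
  lia.
have gap : a + d + 2 * x <= b.
  by apply: (@D4_gap a d b x r y) => //; lia.
have xar : a + x <= r.
  apply: ler_of_mulrr; first by lia.
  rewrite -Er.
  have : a * (a + d + 2 * x) <= a * b by rewrite ler_pM2l; lia.
  lia.
have ybr : d + x <= y.
  apply: ler_of_mulrr; first by lia.
  rewrite -bdy.
  have : d * (a + d + 2 * x) <= d * b by rewrite ler_pM2l; lia.
  lia.
have brd : d + x <= b - r.
  suff : r <= b - d - x by lia.
  apply: ler_of_mulrr; first by lia.
  rewrite -Er.
  have [e [e0 Ee]] : exists e, 0 <= e /\ b = a + d + 2 * x + e.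
    by exists (b - (a + d + 2 * x)); lia.
  have : 0 <= e * (a + 2 * x + e) by rewrite mulr_ge0; lia.
  by rewrite Ee; lia.
have x2 : 2 <= x.
  have : 0 <= a * d by rewrite mulr_ge0; lia.
  by move=> ?; apply: ler_of_mulrr => //; lia.
have H1 : (d + x) * x <= (b - r) * x by rewrite ler_wpM2r; lia.
(* Replacing [y] by [y - 2] sets aside [2 (r - a)], the source of the required [2 r]. Since
   [x^2 = a d + 4], what remains is [2 x (d - 1) + 2 a (d - 1) + 8 > 0]. *)
have H2 : x * (d + x - 2) <= (r - a) * (y - 2).
  by apply: ler_pM; lia.
have : 0 <= x * (d - 1) by rewrite mulr_ge0; lia.
have : 0 <= a * (d - 1) by rewrite mulr_ge0; lia.
lia.
Qed.

(** * Congruence and existence of plane triangles in terms of side lengths *)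

Lemma distC (R : realType) (P Q : plane R) : dist P Q = dist Q P.
Proof. by rewrite /dist; congr Num.sqrt; ring. Qed.

Lemma dist_eqE (R : realType) (P Q P' Q' : plane R) :
  dist P Q = dist P' Q' ->
  (P.1 - Q.1) ^+ 2 + (P.2 - Q.2) ^+ 2
    = (P'.1 - Q'.1) ^+ 2 + (P'.2 - Q'.2) ^+ 2.
Proof.
by move/eqP; rewrite eqr_sqrt ?addr_ge0 ?sqr_ge0 // => /eqP.
Qed.

(** The side lengths determine the inner products of the edge vectors at [A], hence, by Lagrange's
    identity, their determinant up to sign. *)
Lemma side_side_side (R : realType) (A B C A' B' C' : plane R) :
  (B.1 - A.1) * (C.2 - A.2) - (B.2 - A.2) * (C.1 - A.1) != 0 ->
  dist A B = dist A' B' -> dist B C = dist B' C' -> dist C A = dist C' A' ->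
  exists2 f : plane R -> plane R, plane_isometry f &
    [/\ f A = A', f B = B' & f C = C'].
Proof.
move: A B C A' B' C'.
move=> [a1 a2] [b1 b2] [c1 c2] [a1' a2'] [b1' b2'] [c1' c2'] /=.
move=> ncol /dist_eqE /= AB /dist_eqE /= BC /dist_eqE /= CA.
pose u1 := b1 - a1; pose u2 := b2 - a2; pose v1 := c1 - a1; pose v2 := c2 - a2.
pose u1' := b1' - a1'; pose u2' := b2' - a2'.
pose v1' := c1' - a1'; pose v2' := c2' - a2'.
pose n := u1 ^+ 2 + u2 ^+ 2; pose det := u1 * v2 - u2 * v1.
pose det' := u1' * v2' - u2' * v1'; pose e := det' / det.
have det0 : det != 0 by [].
have En : n = u1' ^+ 2 + u2' ^+ 2 by rewrite /n /u1 /u2 /u1' /u2'; lra.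
have Ev : v1 ^+ 2 + v2 ^+ 2 = v1' ^+ 2 + v2' ^+ 2.
  by rewrite /v1 /v2 /v1' /v2'; lra.
have Euv : u1 * v1 + u2 * v2 = u1' * v1' + u2' * v2'.
  by rewrite /u1 /u2 /v1 /v2 /u1' /u2' /v1' /v2'; lra.
have Edet : det' ^+ 2 = det ^+ 2.
  transitivity ((u1' ^+ 2 + u2' ^+ 2) * (v1' ^+ 2 + v2' ^+ 2)
                - (u1' * v1' + u2' * v2') ^+ 2); first by rewrite /det'; ring.
  by rewrite -En -Ev -Euv /n /det; ring.
have e2 : e ^+ 2 = 1 by rewrite /e expr_div_n Edet divff // expf_neq0.
have n0 : n != 0.
  apply: contra det0; rewrite /n paddr_eq0 ?sqr_ge0 // !sqrf_eq0 /det.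
  by move=> /andP[/eqP-> /eqP->]; rewrite !mul0r subrr.
have edet : e * det = det' by rewrite /e divfK.
(* The coordinates (p, q) of P - A in the orthogonal frame (u, u^perp) are
   transported to the frame (u', e u'^perp); the sign e = +-1 selects a rotation
   or a reflection. *)
pose f (P : plane R) : plane R :=
  let p := (u1 * (P.1 - a1) + u2 * (P.2 - a2)) / n in
  let q := e * (u1 * (P.2 - a2) - u2 * (P.1 - a1)) / n in
  (a1' + p * u1' - q * u2', a2' + p * u2' + q * u1').
exists f.
  move=> [p1 p2] [q1 q2]; rewrite /dist; congr Num.sqrt; rewrite /f /=.
  pose w1 := p1 - q1; pose w2 := p2 - q2.
  transitivity (((u1 * w1 + u2 * w2) ^+ 2 + e ^+ 2 * (u1 * w2 - u2 * w1) ^+ 2)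
     / n ^+ 2 * (u1' ^+ 2 + u2' ^+ 2)).
    by rewrite /w1 /w2; field.
  rewrite -En e2 mul1r.
  have -> : (u1 * w1 + u2 * w2) ^+ 2 + (u1 * w2 - u2 * w1) ^+ 2
      = n * (w1 ^+ 2 + w2 ^+ 2) by rewrite /n; ring.
  by rewrite /w1 /w2; field.
split; rewrite /f /=.
- by rewrite !subrr; congr (_, _); field.
- rewrite -/u1 -/u2 -!expr2 -/n mulrC [u1 * u2]mulrC subrr.
  by rewrite divff //; congr (_, _); rewrite /u1' /u2'; ring.
rewrite -/v1 -/v2 -/det edet Euv.
have H1 : (u1' * v1' + u2' * v2') * u1' - det' * u2' = n * v1'.
  by rewrite En /det'; ring.
have H2 : (u1' * v1' + u2' * v2') * u2' + det' * u1' = n * v2'.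
  by rewrite En /det'; ring.
congr (_, _).
- transitivity (a1' + ((u1' * v1' + u2' * v2') * u1' - det' * u2') / n).
    by field.
  by rewrite H1 mulrAC divff // mul1r /v1'; ring.
- transitivity (a2' + ((u1' * v1' + u2' * v2') * u2' + det' * u1') / n).
    by field.
  by rewrite H2 mulrAC divff // mul1r /v2'; ring.
Qed.

Lemma perm_eq3P (T : eqType) (x y z : T) (s : seq T) :
  perm_eq s [:: x; y; z] ->
  [\/ s = [:: x; y; z], s = [:: x; z; y] | s = [:: y; x; z]] \/
  [\/ s = [:: y; z; x], s = [:: z; x; y] | s = [:: z; y; x]].
Proof.
case/(perm_iotaP x) => i; rewrite -mem_permutations => + ->.
have -> : permutations (iota 0 (size [:: x; y; z])) =
  [:: [:: 1; 0; 2]; [:: 0; 1; 2]; [:: 2; 0; 1]; [:: 0; 2; 1]; [:: 1; 2; 0];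
      [:: 2; 1; 0]]%N by vm_compute.
rewrite !inE => /or4P[/eqP->|/eqP->|/eqP->|/or3P[]/eqP->] /=;
  by [left; apply: Or31 | left; apply: Or32 | left; apply: Or33
     | right; apply: Or31 | right; apply: Or32 | right; apply: Or33].
Qed.

Lemma congruentP (R : realType) (T1 T2 : triangle R) :
  congruent T1 T2 <-> perm_eq (sides T1) (sides T2).
Proof.
split=> [[f isof]|].
  rewrite /sides -(isof (vA T1)) -(isof (vB T1)) -(isof (vC T1)).
  by move/perm_eq3P => -[] [] [-> -> ->]; apply/permP => p /=;
    rewrite ?(distC (vB T2) (vA T2)) ?(distC (vC T2) (vB T2))
            ?(distC (vA T2) (vC T2)); lia.
case: T1 T2 => [A B C ncol] [A' B' C' ?].
rewrite /congruent /sides /vertices /= => /perm_eq3P.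
have sss := side_side_side ncol.
(* A permutation of the sides dictates the matching of vertices: the common endpoint of two sides
   goes to the common endpoint of their images. *)
move=> -[] [] [AB BC CA].
- have [f isof [fA fB fC]] := sss A' B' C' AB BC CA.
  by exists f; rewrite // fA fB fC.
- have [|||f isof [fA fB fC]] := sss B' A' C';
    rewrite ?AB ?BC ?CA // 1?distC //.
  by exists f; rewrite // fA fB fC; apply/permP => p /=; lia.
- have [|||f isof [fA fB fC]] := sss C' B' A';
    rewrite ?AB ?BC ?CA // 1?distC //.
  by exists f; rewrite // fA fB fC; apply/permP => p /=; lia.
- have [|||f isof [fA fB fC]] := sss B' C' A';
    rewrite ?AB ?BC ?CA // 1?distC //.
  by exists f; rewrite // fA fB fC; apply/permP => p /=; lia.
- have [|||f isof [fA fB fC]] := sss C' A' B';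
    rewrite ?AB ?BC ?CA // 1?distC //.
  by exists f; rewrite // fA fB fC; apply/permP => p /=; lia.
- have [|||f isof [fA fB fC]] := sss A' C' B';
    rewrite ?AB ?BC ?CA // 1?distC //.
  by exists f; rewrite // fA fB fC; apply/permP => p /=; lia.
Qed.

Lemma triangle_of_sides (R : realType) (p q u : R) :
  0 < u -> p < q + u -> q < p + u -> u < p + q ->
  exists T : triangle R, sides T = [:: p; q; u].
Proof.
move=> u0 pqu qpu upq.
have p0 : 0 < p by lra.
have q0 : 0 < q by lra.
(* Law of cosines: the abscissa of the point at distance [u] from the origin and [q] from
   [(p, 0)]. *)
pose x := (p ^+ 2 + u ^+ 2 - q ^+ 2) / (2 * p).
have y0 : 0 < u ^+ 2 - x ^+ 2.
  (* Heron's formula: the numerator is 16 times the squared area. *)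
  have -> : u ^+ 2 - x ^+ 2 =
    (p + q + u) * (q + u - p) * (p + u - q) * (p + q - u) / (2 * p) ^+ 2.
    by rewrite /x; field; rewrite gt_eqF.
  by rewrite divr_gt0 ?exprn_gt0 ?mulr_gt0 //; lra.
pose y := Num.sqrt (u ^+ 2 - x ^+ 2).
have ncol : (p - 0) * (y - 0) - (0 - 0) * (x - 0) != 0.
  by rewrite !subr0 mul0r subr0 mulf_neq0 // gt_eqF ?sqrtr_gt0.
have y2 : y ^+ 2 = u ^+ 2 - x ^+ 2 by rewrite sqr_sqrtr // ltW.
exists (@Triangle R (0, 0) (p, 0) (x, y) ncol).
rewrite /sides /dist /=; congr [:: _; _; _].
- by rewrite sub0r subrr expr0n addr0 sqrrN sqrtr_sqr ger0_norm ?ltW.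
- rewrite sub0r sqrrN y2.
  have -> : (p - x) ^+ 2 + (u ^+ 2 - x ^+ 2) = q ^+ 2.
    by rewrite /x; field; rewrite gt_eqF.
  by rewrite sqrtr_sqr ger0_norm ?ltW.
- by rewrite !subr0 y2 addrC subrK sqrtr_sqr ger0_norm ?ltW.
Qed.

(** * From triangles to divisors, and the count *)

Lemma D4_triangle_sides (a b c x y z : nat) :
  (0 < a < b)%N -> (b < c)%N ->
  (a * b + 4 = x ^ 2)%N -> (a * c + 4 = y ^ 2)%N -> (b * c + 4 = z ^ 2)%N ->
  (z < x + y)%N -> y = (a + x)%N /\ z = (b + x)%N.
Proof.
move=> ab bc Ex Ey Ez xyz.
have cE : c = (a + b + 2 * x)%N.
  suff : c%:Z = a%:Z + b%:Z + 2 * x%:Z by lia.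
  by apply: (@D4_triangle_regular a b c x y z); lia.
by split; nia.
Qed.

(** Let [b] be the cofactor of [a], so [r^2 - 4 = a b]. Squaring turns the upper bound into
    [a^2 < a b] and the lower one into [a b < a^2 + a r]. *)
Lemma mem_divisors_in_range (R : realType) (r a : nat) : (4 <= r)%N ->
  (a \in divisors_in_range R r) =
    [&& (a %| r ^ 2 - 4)%N, (a < (r ^ 2 - 4) %/ a)%N
      & ((r ^ 2 - 4) %/ a < a + r)%N].
Proof.
move=> r4; rewrite mem_filter -dvdn_divisors; last by nia.
rewrite andbC; case: (boolP (a %| _)%N) => //= /dvdnP[b Eb].
have a0 : (0 < a)%N by nia.
rewrite Eb mulnK // andbC; congr andb.
- rewrite -[a%:R]ger0_norm // -sqrtr_sqr ltr_sqrt; last first.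
    by rewrite subr_gt0 -natrX ltr_nat; lia.
  rewrite -!natrX -natrB; last by lia.
  by rewrite ltr_nat Eb -mulnn ltn_pmul2r.
- rewrite ltr_pdivrMr // ltrBlDr.
  have y0 : 0 <= a%:R * 2 + r%:R :> R by rewrite -natrM -natrD.
  rewrite -[a%:R * 2 + _]ger0_norm // -sqrtr_sqr.
  rewrite -natrX -!natrM -natrD -natrX -natrB; last by lia.
  rewrite ltr_sqrt ?ltr0n; last by nia.
  by rewrite ltr_nat; nia.
Qed.

Local Open Scope card_scope.

Theorem corollary4p4 (R : realType) (r : nat) (hr : (4 <= r)%N) :
  D4_congruence_classes R r #= `I_(size (divisors_in_range R r)).
Proof.
pose s := divisors_in_range R r.
pose k a := ((r ^ 2 - 4) %/ a)%N.
pose side3 a : seq nat := [:: r; a + r; k a + r]%N.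
(* By [congruentP] a class is given by its multiset of sides, so it can be indexed by [a] without
   choosing a representative. *)
pose cls a : set (triangle R) :=
  [set T | perm_eq [seq n%:R | n <- side3 a] (sides T)]%classic.
have sP a : a \in s -> [/\ (0 < a)%N, (a * k a + 4 = r ^ 2)%N,
    (a < k a)%N & (k a < a + r)%N].
  rewrite mem_divisors_in_range // => /and3P[dvd_a ak kar].
  by rewrite /k mulnC divnK //; split => //; nia.
have realize a : a \in s ->
    exists T : triangle R, sides T = [seq n%:R | n <- side3 a].
  case/sP=> a0 Ek ak kar.
  by apply: triangle_of_sides; rewrite -?natrD ?ltr_nat ?ltr0n; lia.
have cls_inj : {in [set i | (i < size s)%N]%classic &,
    injective (fun i => cls (nth 0%N s i))}.
  move=> i j; rewrite !inE /= => si sj Eij.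
  apply/eqP; rewrite -(nth_uniq 0%N si sj) ?filter_uniq ?divisors_uniq //.
  apply/eqP.
  have ai := mem_nth 0%N si; have aj := mem_nth 0%N sj.
  (* A triangle in the common class shows that the two lists of sides are permutations of each
     other; both are sorted, hence equal, and the second entry recovers the divisor. *)
  have [T ET] := realize _ ai.
  have natr_inj : injective (fun n : nat => n%:R : R).
    by move=> m n /eqP; rewrite eqr_nat => /eqP.
  have /(perm_map_inj natr_inj) E : perm_eq
      [seq n%:R : R | n <- side3 (nth 0%N s j)]
      [seq n%:R | n <- side3 (nth 0%N s i)].
    rewrite -ET; suff : cls (nth 0%N s j) T by [].
    by rewrite -Eij /cls /mkset ET.
  have [? _ ? _] := sP _ ai; have [? _ ? _] := sP _ aj.
  suff [/addIn-> _] : side3 (nth 0%N s j) = side3 (nth 0%N s i) by [].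
  by apply: (sorted_eq leq_trans anti_leq) E;
    rewrite /= andbT leq_addl leq_add2r ltnW.
suff -> : D4_congruence_classes R r =
    ((fun i => cls (nth 0%N s i)) @` [set i | (i < size s)%N])%classic.
  exact: inj_card_eq.
apply/seteqP; split=> [_ [T [D4T [rT minT]] <-]|_ [i /= si <-]].
  case: D4T => a [b [c [D4abc abc [tri sidesT]]]].
  case: D4abc => pos _ [x Ex] [y Ey] [z Ez].
  have ab0 : (0 < a)%N by case/and3P: pos.
  move: tri sidesT.
  rewrite Ex Ey Ez !natrX !sqrtr_sqr !ger0_norm // -natrD ltr_nat.
  move=> tri sidesT.
  have [Ey' Ez'] : y = (a + x)%N /\ z = (b + x)%N.
    by apply: (D4_triangle_sides _ _ Ex Ey Ez tri); lia.
  (* The sides are [x], [a + x], [b + x], so [x] is the shortest. *)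
  have Exr : x = r.
    apply/eqP; rewrite eqn_leq -!(ler_nat R) minT; last first.
      by rewrite (perm_mem sidesT) mem_head.
    by move: rT; rewrite (perm_mem sidesT) !inE !eqr_nat andbT ler_nat; lia.
  subst x.
  have Eb : (r ^ 2 - 4 = b * a)%N by lia.
  have kab : k a = b by rewrite /k Eb mulnK.
  have sa : a \in s.
    by rewrite mem_divisors_in_range // -/(k a) kab Eb dvdn_mull //=; lia.
  exists (index a s); first by rewrite /= index_mem.
  rewrite nth_index //; apply/seteqP.
  have E : perm_eq (sides T) [seq n%:R | n <- side3 a].
    by rewrite /side3 /= kab -Ey' -Ez'.
  split=> T' /=.
    rewrite /cls /congruence_class /= => ?; apply/congruentP.
    exact: perm_trans E _.
  rewrite /cls /congruence_class /= => /congruentP.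
  by apply: perm_trans; rewrite perm_sym.
have sa := mem_nth 0%N si; set a := nth _ _ _ in sa *.
have [a0 Ek ak kar] := sP _ sa; have [T ET] := realize _ sa.
exists T; last first.
  apply/seteqP; rewrite /cls /congruence_class /mkset -ET.
  by split=> T' ?; apply/congruentP.
split; last first.
  rewrite /shortest_side ET /= mem_head; split => // x.
  by rewrite !inE => /or3P[]/eqP->; rewrite ler_nat; lia.
(* The regular third element; the triangle inequality then amounts to [kar]. *)
exists a, (k a), (a + k a + 2 * r)%N; split; first split.
- lia.
- by rewrite /= !inE; lia.
- by exists r.
- by exists (a + r)%N; nia.
- by exists (k a + r)%N; nia.
- lia.
have E1 : (a * (a + k a + 2 * r) + 4 = (a + r) ^ 2)%N by lia.
have E2 : (k a * (a + k a + 2 * r) + 4 = (k a + r) ^ 2)%N by lia.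
rewrite /associated ET Ek E1 E2 !natrX !sqrtr_sqr !ger0_norm // -natrD ltr_nat.
by split; [lia | exact: perm_refl].
Qed.
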